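(* Let $k\ge3$ be an integer and $\lambda>0$. For $m\in[0,1]$ let $$S_G(m)=\tfrac12\log(1-m^2)-k\lambda^2m^{2k-2}(1-m^2)-\Big(\sqrt{\tfrac k2}\,\lambda m^k\Big)^2+\sqrt{\tfrac k2}\,\lambda m^k\sqrt{1+\tfrac k2\lambda^2m^{2k}}+\sinh^{-1}\Big(\sqrt{\tfrac k2}\,\lambda m^k\Big),$$ and let $m_c=\left(\frac1\lambda\frac{k-2}{\sqrt{2k(k-1)}}\right)^{1/k}$. The function $S_G$ is non-positive: $S_G(m)\le0$ for all $m\in[0,1]$. Moreover, $S_G(m)=0$ if and only if $m$ satisfies $$m^{2k-4}(1-m^2)=\frac1{2k\lambda^2}.$$ In particular, set $$\lambda_c=\sqrt{\frac1{2k}\,\frac{(k-1)^{k-1}}{(k-2)^{k-2}}}.$$ If $\lambda<\lambda_c$, then $S_G(m)<0$; and if $\lambda\ge\lambda_c$, then $S_G$ has a unique zero in the domain $m\in[m_c,1]$.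
   Context: Here $m$ ranges over $[0,1]$, and $S_G$ takes values in $[-\infty,\infty)$ with the convention $\log0=-\infty$ (so $S_G(1)=-\infty$).
   Formalization: The characterization of the zeros and the claim S_G(m)<0 for λ<λ_c are stated for m in (0,1] instead of [0,1], since S_G(0)=0 for every λ while m=0 does not satisfy the equation. *)

(* Defs.v *)
From HB Require Import structures.
From mathcomp Require Import all_boot all_order all_algebra.
From mathcomp Require Import all_classical all_reals all_analysis.
From mathcomp Require Import ring lra.
Set Implicit Arguments.
Unset Strict Implicit.
Unset Printing Implicit Defensive.
Import Order.TTheory GRing.Theory Num.Theory.

Local Open Scope ring_scope.

Definition sinh (R : realType) (x : R) : R := (expR x - expR (- x)) / 2.

(* The inverse of [sinh] in closed form; [asinhK] and [sinhK] show that it is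
   the two-sided inverse. *)
Definition asinh (R : realType) (x : R) : R := ln (x + Num.sqrt (1 + x ^+ 2)).

(* The library's [ln] is 0 on nonpositive reals, whereas [lne 0 = -oo], so the
   logarithm is taken in the extended reals: [S_G] is -oo at [m = 1]. *)
Definition S_G (R : realType) (k : nat) (lambda m : R) : \bar R :=
  let u := Num.sqrt (k%:R / 2) * lambda * m ^+ k in
  ((1 / 2)%:E * lne (1 - m ^+ 2)%:E
   + (- (k%:R * lambda ^+ 2 * m ^+ (2 * k - 2) * (1 - m ^+ 2))
      - u ^+ 2
      + u * Num.sqrt (1 + k%:R / 2 * lambda ^+ 2 * m ^+ (2 * k))
      + asinh u)%:E)%E.

(* [2 < k] is intended; then the base of the power is positive. *)
Definition m_c (R : realType) (k : nat) (lambda : R) : R :=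
  (1 / lambda * ((k%:R - 2) / Num.sqrt (2 * k%:R * (k%:R - 1))))
    `^ (1 / k%:R).

Definition lambda_c (R : realType) (k : nat) : R :=
  Num.sqrt (1 / (2 * k%:R)
            * ((k%:R - 1) ^+ (k - 1) / (k%:R - 2) ^+ (k - 2))).

Lemma sqrt1D_gt (R : realType) (x : R) : 0 < x + Num.sqrt (1 + x ^+ 2).
Proof.
have h : `|x| < Num.sqrt (1 + x ^+ 2).
  by rewrite -sqrtr_sqr ltr_sqrt ?ltrDr ?ltr_pwDl ?sqr_ge0.
by have := ler_norm (- x); rewrite normrN; lra.
Qed.

Lemma asinhK (R : realType) : cancel (@asinh R) (@sinh R).
Proof.
move=> x; rewrite /sinh /asinh expRN lnK ?posrE ?sqrt1D_gt//.
have := sqrt1D_gt x; set s := Num.sqrt _ => h.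
have s2 : s ^+ 2 = 1 + x ^+ 2 by rewrite sqr_sqrtr// addr_ge0 ?sqr_ge0.
have -> : (x + s)^-1 = s - x.
  apply: (mulfI (lt0r_neq0 h)); rewrite divff ?lt0r_neq0//.
  by rewrite mulrC (addrC x) -subr_sqr s2 addrK.
by field.
Qed.

Lemma sinhK (R : realType) : cancel (@sinh R) (@asinh R).
Proof.
move=> x; rewrite /asinh /sinh expRN; have h := expR_gt0 x.
have -> : 1 + ((expR x - (expR x)^-1) / 2) ^+ 2
          = ((expR x + (expR x)^-1) / 2) ^+ 2 by field; rewrite lt0r_neq0.
rewrite sqrtr_sqr ger0_norm; last first.
  by rewrite divr_ge0 ?addr_ge0 ?invr_ge0 ?expR_ge0.
have -> : (expR x - (expR x)^-1) / 2 + (expR x + (expR x)^-1) / 2 = expR x.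
  by field; rewrite lt0r_neq0.
exact: expRK.
Qed.

Lemma S_G_1 (R : realType) (k : nat) (lambda : R) : S_G k lambda 1 = -oo%E.
Proof.
rewrite /S_G [1 ^+ 2]expr1n subrr le0_lneNy// gt0_muleNy ?addNye//.
Qed.

(* [m = 0] is thus a zero of [S_G] for every [lambda], although it does not
   solve [m ^+ (2 * k - 4) * (1 - m ^+ 2) = 1 / (2 * k%:R * lambda ^+ 2)]. *)
Lemma S_G_0 (R : realType) (k : nat) (lambda : R) :
  (2 < k)%N -> S_G k lambda 0 = 0%E.
Proof.
case: k => [|[|[|k]]]// _.
rewrite /S_G mulnS addSn !exprS !mul0r !mulr0 mul0r subr0.
rewrite (lne1 R) mule0 add0e /asinh.
by rewrite !(mul0r, mulr0, addr0, oppr0, subr0, sqrtr1, add0r, ln1, expr0n).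
Qed.

(* Main.v *)
(* Put [u := sqrt (k / 2) * lambda * m ^+ k], [X := (u + sqrt (1 + u ^+ 2)) ^+ 2]
   and [z := X * (1 - m ^+ 2)].  Since [asinh u] is half the logarithm of [X],
     2 * S_G = ln z + (1 - z) - (1 - z) ^+ 2 / (X - z),
   so that [ln z <= z - 1] gives [S_G <= 0], with equality iff [z = 1], which
   unfolds to the equation on [m].
   That equation reads [t ^+ (k - 2) * (1 - t) = a] with [t := m ^+ 2]; its left
   side peaks at [p := (k - 2) / (k - 1)], and it reaches [a] iff
   [lambda_c <= lambda].  It is strictly decreasing on [p, 1], and a solution
   with [m_c <= m] satisfies [p <= m ^+ 2], hence is unique. *)
Require Import Defs.
From mathcomp Require Import all_boot all_order all_algebra.
From mathcomp Require Import all_classical all_reals all_analysis.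
From mathcomp Require Import ring lra.
Set Implicit Arguments.
Unset Strict Implicit.
Unset Printing Implicit Defensive.
Import Order.TTheory GRing.Theory Num.Theory.
Local Open Scope ring_scope.

(** * Elementary bounds on logarithms and powers *)

Lemma ln_eq_subr1 (R : realType) (z : R) :
  0 < z -> (ln z == z - 1) = (z == 1).
Proof.
move=> z0; apply/eqP/eqP => [h|->]; last by rewrite ln1 subrr.
(* For [z != 1] the bound [1 + x < expR x] is strict at [x = ln z], which refutes [ln z = z - 1]. *)
apply/eqP; rewrite -ln_eq0//; apply: contraT => /expR_gt1Dx.
by rewrite lnK// h subrKC ltxx.
Qed.

(** Convexity by induction: [s] times the bound for one exponent exceeds the bound for the next by a
    nonnegative multiple of [(s - t) ^+ 2]. *)
Lemma exprS_tangent_le (R : realFieldType) (n : nat) (s t : R) :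
  0 <= s -> 0 <= t ->
  t ^+ n.+1 + n.+1%:R * t ^+ n * (s - t) <= s ^+ n.+1.
Proof.
move=> s0 t0; elim: n => [|n IH]; first by rewrite !expr1 expr0 mulr1 mul1r addrC subrK.
rewrite [leRHS]exprS; apply: le_trans (ler_wpM2l s0 IH).
rewrite -subr_ge0.
have -> : s * (t ^+ n.+1 + n.+1%:R * t ^+ n * (s - t)) -
    (t ^+ n.+2 + n.+2%:R * t ^+ n.+1 * (s - t)) =
    t ^+ n * n.+1%:R * (s - t) ^+ 2.
  by rewrite !exprS -(natr1 n.+1); ring.
by rewrite mulr_ge0 ?sqr_ge0// mulr_ge0 ?exprn_ge0.
Qed.

(** The tangent bound times [1 - s] compares two values of [x ^+ n.+1 * (1 - x)] without
    derivatives. The correction term is [t ^+ n * (t - p) ^+ 2] at the peak [s = p], and positive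
    when [p <= s < t]. *)
Lemma exprM_onem_le (R : realFieldType) (n : nat) (s t : R) :
  0 <= s <= 1 -> 0 <= t ->
  t ^+ n.+1 * (1 - t) + t ^+ n * (t - s) * (t - n.+1%:R * (1 - s))
  <= s ^+ n.+1 * (1 - s).
Proof.
move=> /andP[s0 s1] t0.
have s1' : 0 <= 1 - s by rewrite subr_ge0.
apply: le_trans (ler_wpM2r s1' (exprS_tangent_le n s0 t0)).
by rewrite le_eqVlt; apply/orP; left; apply/eqP; rewrite exprS; ring.
Qed.

(** * Maximum and monotonicity of [t ^+ n.+1 * (1 - t)] *)

Section peak.
Variables (R : realFieldType) (n : nat).
Let p : R := n.+1%:R / n.+2%:R.

Lemma peak_itv : 0 < p < 1.
Proof. by rewrite divr_gt0//= ltr_pdivrMr// mul1r ltr_nat. Qed.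

(** The critical point equation of [t ^+ n.+1 * (1 - t)], divided by [t ^+ n]. *)
Lemma peak_onem : n.+1%:R * (1 - p) = p.
Proof. by rewrite /p; field; rewrite -natrD pnatr_eq0. Qed.

Lemma exprM_onem_le_peak (t : R) :
  0 <= t -> t ^+ n.+1 * (1 - t) <= p ^+ n.+1 * (1 - p).
Proof.
move=> t0; have /andP[p0 p1] := peak_itv.
apply: le_trans (exprM_onem_le n _ t0); last by rewrite !ltW.
by rewrite peak_onem lerDl -mulrA mulr_ge0 ?exprn_ge0// -expr2 sqr_ge0.
Qed.

Lemma exprM_onem_decr (s t : R) :
  p <= s -> s < t -> t <= 1 -> t ^+ n.+1 * (1 - t) < s ^+ n.+1 * (1 - s).
Proof.
move=> ps st t1; have /andP[p0 p1] := peak_itv.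
have s0 : 0 < s by lra.
have t0 : 0 < t by lra.
apply: lt_le_trans (exprM_onem_le n _ (ltW t0)); last by apply/andP; split; lra.
rewrite ltrDl !mulr_gt0 ?exprn_gt0// ?subr_gt0//.
apply: le_lt_trans (st); apply: le_trans (ps).
by rewrite -[leRHS]peak_onem ler_wpM2l// lerD2l lerN2.
Qed.

End peak.

(** * Sign and zeros of [S_G] in terms of [z] *)

Section zeros.
Variables (R : realType) (k : nat) (lambda m : R).
Let u : R := Num.sqrt (k%:R / 2) * lambda * m ^+ k.
Let r : R := u + Num.sqrt (1 + u ^+ 2).
Let z : R := r ^+ 2 * (1 - m ^+ 2).

Lemma sqr_u : u ^+ 2 = k%:R / 2 * lambda ^+ 2 * m ^+ (2 * k).
Proof. by rewrite /u !exprMn sqr_sqrtr ?divr_ge0// mulnC exprM. Qed.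

(** Since [asinh u = ln r], this is [u = sinh (ln r)]; it makes the algebra rational in [r] and [m],
    within reach of [field]. *)
Lemma u_half_diff : u = (r - r^-1) / 2.
Proof. by rewrite -[LHS]asinhK /sinh /asinh expRN lnK// posrE sqrt1D_gt. Qed.

Lemma sqr_subz : r ^+ 2 - z = (r * m) ^+ 2.
Proof. by rewrite /z; ring. Qed.

Lemma S_GE : (0 < k)%N -> 0 < m < 1 ->
  S_G k lambda m =
  ((ln z + (1 - z) - (1 - z) ^+ 2 / (r ^+ 2 - z)) / 2)%:E.
Proof.
move=> k0 /andP[m0 m1].
have r0 : 0 < r by exact: sqrt1D_gt.
have w0 : 0 < 1 - m ^+ 2 by rewrite subr_gt0 expr_lt1// ltW.
rewrite /S_G -/u -sqr_u lne_EFin// -EFinM -EFinD; congr EFin.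
have -> : k%:R * lambda ^+ 2 * m ^+ (2 * k - 2) = 2 * u ^+ 2 / m ^+ 2.
  rewrite sqr_u; have -> : m ^+ (2 * k) = m ^+ (2 * k - 2) * m ^+ 2.
    by rewrite -exprD subnK// leq_pmulr.
  by field; rewrite gt_eqF.
have -> : asinh u = ln r by [].
have -> : ln z = ln r *+ 2 + ln (1 - m ^+ 2).
  by rewrite /z lnM ?posrE ?exprn_gt0// lnXn.
have -> : Num.sqrt (1 + u ^+ 2) = r - u by rewrite /r addrAC subrr add0r.
by rewrite sqr_subz u_half_diff /z -mulr_natr; field; rewrite !gt_eqF.
Qed.

Lemma S_G_le0_eq0 : (0 < k)%N -> 0 < m < 1 ->
  (S_G k lambda m <= 0)%E /\ (S_G k lambda m = 0%E <-> z = 1).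
Proof.
move=> k0 m01; rewrite S_GE//; have /andP[m0 m1] := m01.
have r0 : 0 < r by exact: sqrt1D_gt.
have w0 : 0 < 1 - m ^+ 2 by rewrite subr_gt0 expr_lt1// ltW.
have z0 : 0 < z by rewrite mulr_gt0 ?exprn_gt0.
have d0 : 0 <= (1 - z) ^+ 2 / (r ^+ 2 - z).
  by rewrite sqr_subz divr_ge0 ?sqr_ge0.
have lz : ln z <= z - 1.
  by rewrite -{1}[z](subrKC 1) le_ln1Dx// ltrBrDr addrC subrr.
split; first by rewrite lee_fin; lra.
split=> [[h]|->]; last by rewrite ln1 subrr expr0n mul0r subr0 addr0 mul0r.
(* Two nonpositive terms with sum zero both vanish, so [ln z = z - 1]. *)
by apply/eqP; rewrite -ln_eq_subr1//; apply/eqP; lra.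
Qed.

(** With [X = r ^+ 2] and [w = 1 - m ^+ 2] the equation reads [(X - 1) ^+ 2 * w = X * (1 - w) ^+ 2].
    The difference of its sides is [(X * w - 1) * (X - w)], where [X * w = z] and [w < 1 < X]. *)
Lemma z_eq1 : (2 <= k)%N -> 0 < lambda -> 0 < m < 1 ->
  z = 1 <-> m ^+ (2 * k - 4) * (1 - m ^+ 2) = 1 / (2 * k%:R * lambda ^+ 2).
Proof.
move=> k2 l0 /andP[m0 m1].
have r0 : 0 < r by exact: sqrt1D_gt.
have w0 : 0 < 1 - m ^+ 2 by rewrite subr_gt0 expr_lt1// ltW.
have k0 : 0 < k%:R :> R by rewrite ltr0n (leq_trans _ k2).
have u0 : 0 < u by rewrite !mulr_gt0 ?sqrtr_gt0 ?exprn_gt0 ?divr_gt0.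
have r1 : 1 < r ^+ 2.
  have s1 : 1 < Num.sqrt (1 + u ^+ 2).
    by rewrite -[ltLHS]sqrtr1 ltr_sqrt ?ltrDl ?ltr_pwDl ?exprn_gt0 ?sqr_ge0.
  by rewrite expr_gt1 ?ltW// /r; lra.
have E : m ^+ (2 * k - 4) * (1 - m ^+ 2) * (2 * k%:R * lambda ^+ 2) - 1 =
    (z - 1) * (r ^+ 2 - (1 - m ^+ 2)) / (r * m ^+ 2) ^+ 2.
  have -> : m ^+ (2 * k - 4) * (1 - m ^+ 2) * (2 * k%:R * lambda ^+ 2) =
      4 * u ^+ 2 * (1 - m ^+ 2) / m ^+ 4.
    rewrite sqr_u; have -> : m ^+ (2 * k) = m ^+ (2 * k - 4) * m ^+ 4.
      by rewrite -exprD subnK// (leq_mul2l 2 2).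
    by field; rewrite gt_eqF.
  by rewrite {1}u_half_diff /z; field; rewrite !gt_eqF.
have c0 : 2 * k%:R * lambda ^+ 2 != 0 by rewrite gt_eqF// !mulr_gt0.
split=> h.
  apply: (canRL (mulfK c0)); apply/eqP.
  by rewrite -subr_eq0 E h subrr !mul0r.
move: E; rewrite h divfK// subrr => /esym/eqP.
rewrite mulf_eq0 invr_eq0 expf_eq0/= [r * _ == 0]gt_eqF ?mulr_gt0 ?exprn_gt0//.
rewrite orbF mulf_eq0 [X in _ || X]gt_eqF ?orbF; last first.
  by have := exprn_gt0 2 m0; lra.
by rewrite subr_eq0 => /eqP.
Qed.

End zeros.

Lemma S_G_le0 (R : realType) (k : nat) (lambda m : R) :
  (2 < k)%N -> 0 <= m <= 1 -> (S_G k lambda m <= 0)%E.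
Proof.
move=> k2 /andP[]; rewrite le_eqVlt => /predU1P[<- _|m0]; first by rewrite S_G_0.
rewrite le_eqVlt => /predU1P[->|m1]; first by rewrite S_G_1 leNye.
by have [] := @S_G_le0_eq0 R k lambda m (ltn_trans _ k2) _ => //; rewrite m0.
Qed.

Lemma S_G_eq0 (R : realType) (k : nat) (lambda m : R) :
  (2 < k)%N -> 0 < lambda -> 0 < m <= 1 ->
  S_G k lambda m = 0%E <->
  m ^+ (2 * k - 4) * (1 - m ^+ 2) = 1 / (2 * k%:R * lambda ^+ 2).
Proof.
move=> k2 l0 /andP[m0]; rewrite le_eqVlt => /predU1P[->|m1].
  (* At [m = 1] both sides are false: [S_G] is -oo, and 0 is not the positive right-hand side. *)
  rewrite S_G_1 !expr1n subrr mulr0; split=> // /esym/eqP; rewrite gt_eqF//.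
  by rewrite divr_gt0 ?mulr_gt0 ?exprn_gt0 ?ltr0n// (ltn_trans _ k2).
have m01 : 0 < m < 1 by rewrite m0.
rewrite -z_eq1//; last exact: ltnW.
by have [] := @S_G_le0_eq0 R k lambda m (ltn_trans _ k2) m01.
Qed.

(** * The thresholds [lambda_c] and [m_c], and existence of a solution *)

Section solutions.
Variables (R : realType) (n : nat) (lambda : R).
Hypothesis lambda_gt0 : 0 < lambda.
Let k := n.+3.
Let p : R := n.+1%:R / n.+2%:R.
Let a : R := 1 / (2 * k%:R * lambda ^+ 2).

Lemma exprM_onem_sqr (m : R) :
  m ^+ (2 * k - 4) * (1 - m ^+ 2) = (m ^+ 2) ^+ n.+1 * (1 - m ^+ 2).
Proof. by rewrite -exprM /k mulnS mulnS addnA addKn. Qed.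

(** The level [a] decreases in [lambda] and equals the peak value
    [n.+1%:R ^+ n.+1 / n.+2%:R ^+ n.+2] at [lambda_c]. *)
Lemma lambda_c_le : (lambda_c R k <= lambda) = (a <= p ^+ n.+1 * (1 - p)).
Proof.
have k0 : 0 < k%:R :> R by [].
have k1 : k%:R - 1 = n.+2%:R :> R by rewrite /k -natr1 addrK.
have k2 : k%:R - 2 = n.+1%:R :> R by rewrite /k -[n.+3]addn2 natrD addrK.
rewrite /lambda_c k1 k2 /k !subSS !subn0 -/k.
have -> : p ^+ n.+1 * (1 - p) = n.+1%:R ^+ n.+1 / n.+2%:R ^+ n.+2.
  have -> : 1 - p = n.+2%:R^-1.
    by rewrite /p; field; rewrite -natrD pnatr_eq0.
  by rewrite /p expr_div_n -mulrA -invfM -exprSr.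
rewrite -[X in _ <= X]gtr0_norm// -sqrtr_sqr ler_sqrt ?sqr_ge0// /a.
have A0 : 0 < n.+1%:R ^+ n.+1 :> R by exact: exprn_gt0.
have B0 : 0 < n.+2%:R ^+ n.+2 :> R by exact: exprn_gt0.
have l0 : 0 < lambda ^+ 2 by exact: exprn_gt0.
have c0 : 0 < 2 * k%:R :> R by exact: mulr_gt0.
rewrite !div1r mulrA ler_pdivrMr// ler_pdivrMl// ler_pdivlMr// ler_pdivrMl ?mulr_gt0//.
by congr (_ <= _); ring.
Qed.

(** Raising both sides to the power [2 * k] removes the real power and the square root. *)
Lemma m_c_le (m : R) : 0 <= m ->
  (m_c k lambda <= m) = (a * n.+1%:R ^+ 2 <= n.+2%:R * (m ^+ 2) ^+ k).
Proof.
move=> m0; have k0 : 0 < k%:R :> R by [].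
have k1 : k%:R - 1 = n.+2%:R :> R by rewrite /k -natr1 addrK.
have k2 : k%:R - 2 = n.+1%:R :> R by rewrite /k -[n.+3]addn2 natrD addrK.
rewrite /m_c k1 k2; set x := 1 / lambda * _.
have s0 : 0 < 2 * k%:R * n.+2%:R :> R by rewrite !mulr_gt0.
have x0 : 0 <= x by rewrite mulr_ge0 ?divr_ge0 ?sqrtr_ge0 ?ltW.
have xk : (x `^ (1 / k%:R)) ^+ k = x.
  by rewrite -powR_mulrn ?powR_ge0// -powRrM divfK ?gt_eqF// powRr1.
rewrite -(@ler_pXn2r _ k)// ?nnegrE ?powR_ge0// xk.
rewrite -(@ler_pXn2r _ 2)// ?nnegrE ?exprn_ge0//.
rewrite -exprM mulnC exprM -[RHS]ler_pdivrMl//; congr (_ <= _).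
rewrite /x /a exprMn expr_div_n [(_ / Num.sqrt _) ^+ 2]expr_div_n sqr_sqrtr ?ltW//.
by field; rewrite !gt_eqF.
Qed.

(* Eliminating [a] from [m_c_le] leaves
   [0 <= (n.+2%:R * t - n.+1%:R) * (t + n.+1%:R)] with [t := m ^+ 2]. *)
Lemma peak_le_of_m_c_le (m : R) : 0 < m -> m_c k lambda <= m ->
  m ^+ (2 * k - 4) * (1 - m ^+ 2) = a -> p <= m ^+ 2.
Proof.
move=> m0; rewrite (m_c_le (ltW m0)) exprM_onem_sqr => + ma; rewrite -{}ma.
have t0 := exprn_gt0 2 m0; set t := m ^+ 2 in t0 *.
have -> : n.+2%:R * t ^+ k = t ^+ n.+1 * (n.+2%:R * t ^+ 2).
  by rewrite [RHS]mulrCA -exprD addn2.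
rewrite -mulrA ler_pM2l ?exprn_gt0// -subr_ge0.
have -> : n.+2%:R * t ^+ 2 - (1 - t) * n.+1%:R ^+ 2 =
    (n.+2%:R * t - n.+1%:R) * (t + n.+1%:R) by rewrite -(natr1 n.+1); ring.
by rewrite pmulr_lge0 ?addr_gt0// subr_ge0 /p ler_pdivrMr// mulrC.
Qed.

(** By [m_c_le], [m_c] grows with [a], and it equals [Num.sqrt p] when [a] is the peak value. *)
Lemma m_c_le_sqrt_peak :
  a <= p ^+ n.+1 * (1 - p) -> m_c k lambda <= Num.sqrt p.
Proof.
have /andP[p0 _] := peak_itv R n.
move=> ap; rewrite m_c_le ?sqrtr_ge0// (sqr_sqrtr (ltW p0)).
apply: le_trans (ler_wpM2r _ ap) _; first exact: sqr_ge0.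
rewrite le_eqVlt; apply/orP; left; apply/eqP.
rewrite /k -[n.+3]addn2 exprD -mulrA [RHS]mulrCA; congr (_ * _).
by rewrite /p; field; rewrite -natrD pnatr_eq0.
Qed.

Lemma exists_solution : a <= p ^+ n.+1 * (1 - p) ->
  exists2 m : R, Num.sqrt p <= m <= 1 &
    m ^+ (2 * k - 4) * (1 - m ^+ 2) = a.
Proof.
move=> ap; have /andP[p0 p1] := peak_itv R n.
(* The sign is chosen so that [q] is nonpositive at [Num.sqrt p] and nonnegative at 1, as [poly_ivt]
   requires. *)
pose q : {poly R} := a%:P - 'X^(2 * k - 4) * (1 - 'X^2).
have qE x : q.[x] = a - x ^+ (2 * k - 4) * (1 - x ^+ 2) by rewrite !hornerE.
have [||m mI /rootP] := @poly_ivt R q (Num.sqrt p) 1.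
- by rewrite -[leRHS]sqrtr1 ler_wsqrtr// ltW.
- rewrite !qE expr1n [1 ^+ 2]expr1n subrr mulr0 subr0.
  rewrite exprM_onem_sqr (sqr_sqrtr (ltW p0)) subr_le0 ap/=.
  by rewrite divr_ge0 ?mulr_ge0 ?exprn_ge0 ?ltW.
by rewrite qE => /eqP; rewrite subr_eq0 => /eqP am; exists m.
Qed.

End solutions.

Theorem proposition2 (R : realType) (k : nat) (lambda : R)
    (hk : (3 <= k)%N) (hlambda : 0 < lambda) :
  [/\ (forall m : R, 0 <= m <= 1 -> (S_G k lambda m <= 0)%E),
      (forall m : R, 0 < m <= 1 ->
         (S_G k lambda m = 0%E <->
          m ^+ (2 * k - 4) * (1 - m ^+ 2) = 1 / (2 * k%:R * lambda ^+ 2))),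
      (lambda < lambda_c R k ->
         forall m : R, 0 < m <= 1 -> (S_G k lambda m < 0)%E)
    & (lambda_c R k <= lambda ->
         exists! m : R, m_c k lambda <= m <= 1 /\ S_G k lambda m = 0%E)].
Proof.
split.
- by move=> m; exact: S_G_le0.
- by move=> m; exact: S_G_eq0.
- case: k hk => [|[|[|n]]]// hk lc m m01; have /andP[m0 m1] := m01.
  rewrite lt_neqAle S_G_le0 ?(ltW m0)// andbT.
  apply/eqP => /S_G_eq0 -/(_ hk hlambda m01); rewrite exprM_onem_sqr => h.
  move: lc; rewrite ltNge lambda_c_le// -h.
  by rewrite exprM_onem_le_peak// exprn_ge0// ltW.
- case: k hk => [|[|[|n]]]// hk; rewrite lambda_c_le// => ap.
  have /andP[p0 p1] := peak_itv R n.
  have sp0 : 0 < Num.sqrt (n.+1%:R / n.+2%:R : R) by rewrite sqrtr_gt0.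
  have [m /andP[pm m1] mE] := exists_solution hlambda ap.
  have m0 : 0 < m by exact: lt_le_trans pm.
  have mc : m_c n.+3 lambda <= m by exact: le_trans (m_c_le_sqrt_peak _ _) pm.
  exists m; split; first by rewrite mc m1 S_G_eq0 ?m0.
  move=> m' [/andP[mc' m1'] S0].
  (* Positivity of [m_c] keeps [m'] away from the zero of [S_G] at 0, which does not solve the
     equation. *)
  have xgt0 : 0 < 1 / lambda * ((n.+3%:R - 2) / Num.sqrt (2 * n.+3%:R * (n.+3%:R - 1))).
    rewrite mulr_gt0 ?divr_gt0 ?sqrtr_gt0 ?mulr_gt0 ?subr_gt0 ?ltr_nat//.
    by rewrite ltr1n.
  have m0' : 0 < m' by apply: lt_le_trans mc'; exact: powR_gt0.
  have mE' : m' ^+ (2 * n.+3 - 4) * (1 - m' ^+ 2) = 1 / (2 * n.+3%:R * lambda ^+ 2).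
    by apply/S_G_eq0; rewrite ?m0'.
  have pt := peak_le_of_m_c_le hlambda m0 mc mE.
  have pt' := peak_le_of_m_c_le hlambda m0' mc' mE'.
  have E : (m ^+ 2) ^+ n.+1 * (1 - m ^+ 2) = (m' ^+ 2) ^+ n.+1 * (1 - m' ^+ 2).
    by rewrite -!exprM_onem_sqr mE mE'.
  have le1 x : 0 < x -> x <= 1 -> x ^+ 2 <= 1 :> R.
    by move=> x0 x1; rewrite expr_le1// ltW.
  apply/eqP; rewrite -(@eqrXn2 _ 2) ?ltW//.
  (* Both squares lie in [[p, 1]], where strict decrease forbids equal values at distinct points. *)
  have [lt|lt|//] := ltgtP (m ^+ 2) (m' ^+ 2).
    by have := exprM_onem_decr pt lt (le1 _ m0' m1'); rewrite E ltxx.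
  by have := exprM_onem_decr pt' lt (le1 _ m0 m1); rewrite E ltxx.
Qed.
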